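(* Let $T$ be a $\mathbf{B}$-derivation whose root is labeled by $X\Rightarrow A$, and let $\sigma$ be an $\mathsf{rseq}$-substitution. Then $\sigma^{\varepsilon}(T)$ is again a $\mathbf{B}$-derivation, and its root is labeled by $\sigma^{\varepsilon}(X)\Rightarrow\sigma^{\varepsilon}(A)$.
   Context: Language. Fix a countably infinite set of atoms $\mathsf{At}$. Formulas are built from atoms by $\neg$ and the binary connectives $\land,\lor,\to,\circ$. Bunches are built from formulas by two binary operations, comma $(X,Y)$ and semicolon $(X;Y)$. A consecution is $X\Rightarrow A$ with $X$ a bunch, $A$ a formula. The parsing tree of a bunch has it at the root; a node $X;Y$, $X,Y$, $A\land B$, $A\lor B$, $A\to B$, $A\circ B$ has children $X,Y$ (resp. $A,B$) in order, $\neg A$ has child $A$, atoms are leaves; occurrences of subexpressions are nodes. $Y(X)$ denotes $Y$ with a distinguished occurrence of a subbunch $X$; $Y(Z)$ replaces it by $Z$. Sequences. Let $\mathsf{seq}$ be the set of finite sequences over the alphabet $\{l,r,\lambda,\rho,n\}$, $\varepsilon$ the empty sequence, juxtaposition = concatenation. One-step reduction $\rightsquigarrow'$ is generated by: $\overline{x}l\lambda\overline{y}\rightsquigarrow'\overline{x}\rho\overline{y}$; $\overline{x}r\lambda\overline{y}\rightsquigarrow'\overline{x}\overline{y}$; $\overline{x}\lambda r\overline{y}\rightsquigarrow'\overline{x}\overline{y}$; $\overline{x}\rho r\overline{y}\rightsquigarrow'\overline{x}l\overline{y}$; $\overline{x}nn\overline{y}\rightsquigarrow'\overline{x}\overline{y}$.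 A sequence is reduced if no such step applies; $\mathsf{rseq}$ is the set of reduced sequences; $\rightsquigarrow$ is the reflexive-transitive closure of $\rightsquigarrow'$. Every $\overline{z}$ reduces to exactly one reduced sequence, denoted $\mathsf{red}(\overline{z})$. $\mathsf{rseq}$-annotation. Annotate the parsing tree of a bunch: root gets $\varepsilon$; if a node gets $\overline{x}$: for $X;Y$ and $A\circ B$ the left child gets $\mathsf{red}(\lambda\overline{x})$ and the right child $\mathsf{red}(\rho\overline{x})$; for $A\to B$, $A$ gets $\mathsf{red}(l\overline{x})$ and $B$ gets $\mathsf{red}(r\overline{x})$; for $\neg A$, $A$ gets $\mathsf{red}(n\overline{x})$; children of $X,Y$, $A\land B$, $A\lor B$ get $\overline{x}$. An occurrence falls under its annotation. $\mathsf{rseq}$-substitutions. A function $\sigma:\mathsf{rseq}\times\mathsf{At}\to$ formulas, written $\sigma^{\overline{x}}(p)$, extended to bunches by $\sigma^{\overline{x}}(A\land B)=\sigma^{\overline{x}}(A)\land\sigma^{\overline{x}}(B)$, $\sigma^{\overline{x}}(A\lor B)=\sigma^{\overline{x}}(A)\lor\sigma^{\overline{x}}(B)$, $\sigma^{\overline{x}}(\neg A)=\neg\sigma^{\mathsf{red}(n\overline{x})}(A)$, $\sigma^{\overline{x}}(A\to B)=\sigma^{\mathsf{red}(l\overline{x})}(A)\to\sigma^{\mathsf{red}(r\overline{x})}(B)$, $\sigma^{\overline{x}}(A\circ B)=\sigma^{\mathsf{red}(\lambda\overline{x})}(A)\circ\sigma^{\mathsf{red}(\rho\overline{x})}(B)$,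 $\sigma^{\overline{x}}(X,Y)=\sigma^{\overline{x}}(X),\sigma^{\overline{x}}(Y)$, $\sigma^{\overline{x}}(X;Y)=\sigma^{\mathsf{red}(\lambda\overline{x})}(X);\sigma^{\mathsf{red}(\rho\overline{x})}(Y)$. For $\overline{w},\overline{y}\in\mathsf{rseq}$, the $\mathsf{rseq}$-substitution $\sigma_{\overline{w}\mapsto\overline{y}}$ is given on atoms by $\sigma^{\overline{x}}_{\overline{w}\mapsto\overline{y}}(p)=\sigma^{\mathsf{red}(\overline{z}\overline{y})}(p)$ if $\overline{z}\overline{w}\rightsquigarrow\overline{x}$ for some $\overline{z}\in\mathsf{seq}$ (independent of the choice of $\overline{z}$), and $\sigma^{\overline{x}}(p)$ otherwise. Rules of $\mathbf{B}$ (premises in order / conclusion): (id): $A\Rightarrow A$, no premises. ($\to$I): $X;A\Rightarrow B$ / $X\Rightarrow A\to B$. ($\to$E): $X\Rightarrow A\to B$, $Y\Rightarrow A$ / $X;Y\Rightarrow B$. ($\lor$I$_1$): $X\Rightarrow A$ / $X\Rightarrow A\lor B$. ($\lor$I$_2$): $X\Rightarrow B$ / $X\Rightarrow A\lor B$. ($\lor$E): $X\Rightarrow A\lor B$, $Y(A)\Rightarrow C$, $Y(B)\Rightarrow C$ / $Y(X)\Rightarrow C$. ($\land$I): $X\Rightarrow A$, $Y\Rightarrow B$ / $X,Y\Rightarrow A\land B$. ($\land$E): $X\Rightarrow A\land B$, $Y(A,B)\Rightarrow C$ / $Y(X)\Rightarrow C$. ($\circ$I): $X\Rightarrow A$, $Y\Rightarrow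 B$ / $X;Y\Rightarrow A\circ B$. ($\circ$E): $X\Rightarrow A\circ B$, $Y(A;B)\Rightarrow C$ / $Y(X)\Rightarrow C$. ($\neg$I): $X\Rightarrow B$, $A\Rightarrow\neg B$ / $X\Rightarrow\neg A$. ($\neg$E): $X\Rightarrow\neg\neg A$ / $X\Rightarrow A$. (Cut): $X\Rightarrow A$, $Y(A)\Rightarrow B$ / $Y(X)\Rightarrow B$. Structural: (eB) $W(X,(Y,Z))\Rightarrow A$ / $W((X,Y),Z)\Rightarrow A$; (eC) $W(X,Y)\Rightarrow A$ / $W(Y,X)\Rightarrow A$; (eW) $W(X,X)\Rightarrow A$ / $W(X)\Rightarrow A$; (eK) $W(X)\Rightarrow A$ / $W(X,Y)\Rightarrow A$. Derivations. A $\mathbf{B}$-pseudoderivation is a finite tree of nodes labeled by consecutions or rule names, rooted at a consecution node, with consecution nodes adjacent only to rule nodes and a node for a rule with $k$ premises adjacent to exactly $k+1$ consecution nodes (conclusion below, premises above). A $\mathbf{B}$-derivation is a pseudoderivation with at least one rule node in which every rule node with its neighbours is an instance of its rule. Action on derivations. $\sigma^{\overline{x}}(T)$ is defined recursively: a single consecution node $X\Rightarrow A$ goes to $\sigma^{\overline{x}}(X)\Rightarrow\sigma^{\overline{x}}(A)$; the (id) derivation of $A\Rightarrow A$ goes to the (id) derivation of $\sigma^{\overline{x}}(A)\Rightarrow\sigma^{\overline{x}}(A)$; if $T$ ends with rule $R$, conclusion $X\Rightarrow A$ and premise subtrees $S_1,\dots,S_k$, then $\sigma^{\overline{x}}(T)$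 ends with $R$, conclusion $\sigma^{\overline{x}}(X)\Rightarrow\sigma^{\overline{x}}(A)$, and premise subtrees $(\sigma_{R_1})^{\overline{x}}(S_1),\dots,(\sigma_{R_k})^{\overline{x}}(S_k)$, where: $\sigma_{R_1}=\sigma_{\lambda\mapsto\varepsilon}$ for ($\to$I); $\sigma_{R_1}=\sigma_{\varepsilon\mapsto\lambda}$ and $\sigma_{R_2}=\sigma_{\varepsilon\mapsto\rho}$ for ($\to$E) and ($\circ$I); for ($\lor$E), ($\land$E), ($\circ$E), (Cut) with conclusion $Y(X)\Rightarrow C$, $\sigma_{R_1}=\sigma_{\varepsilon\mapsto\overline{x}_0}$ where $\overline{x}_0$ is the sequence under which the distinguished occurrence of $X$ in $Y(X)$ falls; $\sigma_{R_2}=\sigma_{n\mapsto\varepsilon}$ for ($\neg$I) (the premise $A\Rightarrow\neg B$); and $\sigma_{R_i}=\sigma$ for all other premises of all rules. *)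

(* Defs.v *)
From HB Require Import structures.
From Stdlib Require Import Relation_Operators.
From mathcomp Require Import all_boot.
From mathcomp Require Import boolp.

Set Implicit Arguments.
Unset Strict Implicit.
Unset Printing Implicit Defensive.

Declare Scope bunch_scope.
Delimit Scope bunch_scope with B.
Local Open Scope bunch_scope.

(** * Formulas, bunches, consecutions *)

Inductive formula (At : Type) : Type :=
| Atom of At
| Neg of formula At
| And of formula At & formula At
| Or of formula At & formula At
| Imp of formula At & formula At
| Fus of formula At & formula At.

Inductive bunch (At : Type) : Type :=
| Fm of formula At
| Comma of bunch At & bunch At
| Semi of bunch At & bunch At.

Coercion Fm : formula >-> bunch.

Record consecution (At : Type) : Type :=
  Consecution { ant : bunch At; suc : formula At }.

Notation "X ⇒ A" := (Consecution X A) (at level 70) : bunch_scope.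

(* Bunches with one hole: [fill Y X] is Y(X).  The hole sits at a bunch node,
   never strictly inside a formula. *)
Inductive bctx (At : Type) : Type :=
| Hole
| CommaL of bctx At & bunch At
| CommaR of bunch At & bctx At
| SemiL of bctx At & bunch At
| SemiR of bunch At & bctx At.

Fixpoint fill (At : Type) (Y : bctx At) (X : bunch At) : bunch At :=
  match Y with
  | Hole => X
  | CommaL Y1 Y2 => Comma (fill Y1 X) Y2
  | CommaR Y1 Y2 => Comma Y1 (fill Y2 X)
  | SemiL Y1 Y2 => Semi (fill Y1 X) Y2
  | SemiR Y1 Y2 => Semi Y1 (fill Y2 X)
  end.

Inductive side : Type := Left | Right.

(* The path from the root of Y(X) to the distinguished occurrence of X. *)
Fixpoint hole_path (At : Type) (Y : bctx At) : seq side :=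
  match Y with
  | Hole => [::]
  | CommaL Y1 _ => Left :: hole_path Y1
  | CommaR _ Y2 => Right :: hole_path Y2
  | SemiL Y1 _ => Left :: hole_path Y1
  | SemiR _ Y2 => Right :: hole_path Y2
  end.

(** * Sequences and their reduction *)

(* The letters l, r, lambda, rho, n. *)
Inductive letter : Type := Ll | Lr | Lam | Rho | Ln.

Inductive step : seq letter -> seq letter -> Prop :=
| step_l_lam x y : step (x ++ [:: Ll; Lam] ++ y) (x ++ [:: Rho] ++ y)
| step_r_lam x y : step (x ++ [:: Lr; Lam] ++ y) (x ++ y)
| step_lam_r x y : step (x ++ [:: Lam; Lr] ++ y) (x ++ y)
| step_rho_r x y : step (x ++ [:: Rho; Lr] ++ y) (x ++ [:: Ll] ++ y)
| step_n_n x y : step (x ++ [:: Ln; Ln] ++ y) (x ++ y).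

Definition reduces : seq letter -> seq letter -> Prop := clos_refl_trans _ step.

Definition redex (a b : letter) : bool :=
  match a, b with
  | Ll, Lam | Lr, Lam | Lam, Lr | Rho, Lr | Ln, Ln => true
  | _, _ => false
  end.

(* No two adjacent letters form a redex; see [reducedP]. *)
Definition reduced (z : seq letter) : bool := sorted (fun a b => ~~ redex a b) z.

Lemma reducedP z : reflect (forall z', ~ step z z') (reduced z).
Proof.
apply: (iffP idP) => [rz z' st|].
  case: st rz => x y; rewrite /reduced;
    by case: x => [|a x] //=; rewrite cat_path /= !andbF.
elim: z => [|a [|b z] IH] //= nst.
apply/andP; split.
  case: a b nst {IH} => [] [] //= nst; exfalso.
  - exact: nst _ (step_l_lam [::] z).
  - exact: nst _ (step_r_lam [::] z).
  - exact: nst _ (step_lam_r [::] z).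
  - exact: nst _ (step_rho_r [::] z).
  - exact: nst _ (step_n_n [::] z).
apply: IH => z' st; apply: (nst (a :: z')).
case: st => x y; rewrite -!cat_cons.
- exact: step_l_lam.
- exact: step_r_lam.
- exact: step_lam_r.
- exact: step_rho_r.
- exact: step_n_n.
Qed.

Record rseq : Type := Rseq { rval :> seq letter; _ : reduced rval }.
HB.instance Definition _ := [isSub for rval].

Definition eps : rseq := @Rseq [::] isT.
Definition single (a : letter) : rseq := @Rseq [:: a] isT.

(* The normal form of [a :: z] when [z] is reduced. *)
Definition push (a : letter) (z : seq letter) : seq letter :=
  match a, z with
  | Ll, Lam :: z' => Rho :: z'
  | Lr, Lam :: z' => z'
  | Lam, Lr :: z' => z'
  | Rho, Lr :: z' => Ll :: z'
  | Ln, Ln :: z' => z'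
  | _, _ => a :: z
  end.

Lemma push_reduced a z : reduced z -> reduced (push a z).
Proof. by case: a z => [] [|[] [|[] z]]. Qed.

Lemma nf_reduced z : reduced (foldr push [::] z).
Proof. by elim: z => //= a z; apply: push_reduced. Qed.

(* [red z] is the unique reduced sequence to which [z] reduces:
   [reduces_red] and [red_unique]. *)
Definition red (z : seq letter) : rseq := Rseq (nf_reduced z).

Lemma step_cons a z z' : step z z' -> step (a :: z) (a :: z').
Proof.
case=> x y; rewrite -!cat_cons.
- exact: step_l_lam.
- exact: step_r_lam.
- exact: step_lam_r.
- exact: step_rho_r.
- exact: step_n_n.
Qed.

Lemma reduces_cons a z z' : reduces z z' -> reduces (a :: z) (a :: z').
Proof.
elim=> [x y /(step_cons a)|x|x y w _ xy _ yw]; first exact: rt_step.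
  exact: rt_refl.
exact: rt_trans xy yw.
Qed.

Lemma reduces_push a z : reduces (a :: z) (push a z).
Proof.
case: a z => [] [|[] z] /=; try exact: rt_refl; apply: rt_step.
- exact: (step_l_lam [::] z).
- exact: (step_r_lam [::] z).
- exact: (step_lam_r [::] z).
- exact: (step_rho_r [::] z).
- exact: (step_n_n [::] z).
Qed.

Lemma reduces_red z : reduces z (red z).
Proof.
elim: z => [|a z IH]; first exact: rt_refl.
exact: rt_trans (reduces_cons a IH) (reduces_push a _).
Qed.

Lemma foldr_push_id z : reduced z -> foldr push [::] z = z.
Proof.
elim: z => //= a z IH rz.
have rz' : reduced z by case: z rz {IH} => //= b z /andP[].
rewrite (IH rz').
by case: a z rz {IH rz'} => [] [|[] z].
Qed.

Lemma push_redex w : reduced w ->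
  [/\ push Ll (push Lam w) = push Rho w, push Lr (push Lam w) = w,
      push Lam (push Lr w) = w, push Rho (push Lr w) = push Ll w
    & push Ln (push Ln w) = w].
Proof. by case: w => [|[] [|[] w]]. Qed.

Lemma step_nf z z' : step z z' -> foldr push [::] z = foldr push [::] z'.
Proof.
case=> x y; rewrite !foldr_cat;
  have [e1 e2 e3 e4 e5] := push_redex (nf_reduced y).
- exact: (congr1 (fun w => foldr push w x) e1).
- exact: (congr1 (fun w => foldr push w x) e2).
- exact: (congr1 (fun w => foldr push w x) e3).
- exact: (congr1 (fun w => foldr push w x) e4).
- exact: (congr1 (fun w => foldr push w x) e5).
Qed.

Lemma reduces_nf z z' : reduces z z' -> foldr push [::] z = foldr push [::] z'.
Proof. by elim=> [x y /step_nf|//|x y w _ -> _ ->]. Qed.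

Lemma red_unique z z' : reduces z z' -> reduced z' -> z' = red z.
Proof. by move=> /reduces_nf /= -> /foldr_push_id ->. Qed.

(** * rseq-substitutions *)

Definition rsubst (At : Type) : Type := rseq -> At -> formula At.

Fixpoint subst_formula (At : Type) (s : rsubst At) (x : rseq) (A : formula At)
    : formula At :=
  match A with
  | Atom p => s x p
  | Neg A1 => Neg (subst_formula s (red (Ln :: x)) A1)
  | And A1 A2 => And (subst_formula s x A1) (subst_formula s x A2)
  | Or A1 A2 => Or (subst_formula s x A1) (subst_formula s x A2)
  | Imp A1 A2 =>
      Imp (subst_formula s (red (Ll :: x)) A1) (subst_formula s (red (Lr :: x)) A2)
  | Fus A1 A2 =>
      Fus (subst_formula s (red (Lam :: x)) A1) (subst_formula s (red (Rho :: x)) A2)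
  end.

Fixpoint subst_bunch (At : Type) (s : rsubst At) (x : rseq) (X : bunch At)
    : bunch At :=
  match X with
  | Fm A => Fm (subst_formula s x A)
  | Comma X1 X2 => Comma (subst_bunch s x X1) (subst_bunch s x X2)
  | Semi X1 X2 =>
      Semi (subst_bunch s (red (Lam :: x)) X1) (subst_bunch s (red (Rho :: x)) X2)
  end.

Definition subst_consecution (At : Type) (s : rsubst At) (x : rseq)
    (c : consecution At) : consecution At :=
  subst_bunch s x (ant c) ⇒ subst_formula s x (suc c).

(* sigma_{w |-> y}.  The choice of z is immaterial: [retargetE]. *)
Definition retarget (At : Type) (s : rsubst At) (w y : rseq) : rsubst At :=
  fun x p =>
    match pselect (exists z : seq letter, reduces (z ++ w) x) with
    | left h => s (red (projT1 (cid h) ++ y)) p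
    | right _ => s x p
    end.

Lemma red_catl x y : red (x ++ y) = red (red x ++ y).
Proof.
apply: val_inj => /=; elim: x => //= a x ->.
set u := foldr push [::] x.
have ru : reduced u by exact: nf_reduced.
case: a u ru => [] [|[] u] //= _;
  have [e1 e2 e3 e4 e5] := push_redex (nf_reduced (u ++ y)).
- exact: e1.
- exact: e2.
- exact: e3.
- exact: e4.
- exact: e5.
Qed.

Lemma nf_rcons_l z : reduced z -> foldr push [::] (rcons z Ll) = rcons z Ll.
Proof.
move=> rz; apply: foldr_push_id.
by case: z rz => //= a z rz; rewrite rcons_path rz /=; case: (last a z).
Qed.

Lemma red_cancel_letter a z z' : red (rcons z a) = red (rcons z' a) -> red z = red z'.
Proof.
have inv b c : (forall u, reduced u -> push b (push c u) = u) ->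
    forall v, red v = red (rcons (rcons v b) c).
  move=> h v; apply: val_inj; rewrite /= -!cats1 -catA foldr_cat /=.
  by rewrite (h [::] isT).
have congr b v v' : red v = red v' -> red (rcons v b) = red (rcons v' b).
  by move=> e; rewrite -!cats1 red_catl e -red_catl.
have cl v v' : red (rcons v Ll) = red (rcons v' Ll) -> red v = red v'.
  rewrite -!cats1 red_catl [RHS]red_catl !cats1 => /(congr1 val) /=.
  rewrite !nf_rcons_l ?nf_reduced // => /rcons_inj[e].
  exact: val_inj.
have h1 u : reduced u -> push Lam (push Lr u) = u by case/push_redex.
have h2 u : reduced u -> push Lr (push Lam u) = u by case/push_redex.
have h3 u : reduced u -> push Ln (push Ln u) = u by case/push_redex.
case: a => e.
- exact: cl.
- by rewrite (inv _ _ h2 z) (inv _ _ h2 z'); apply: congr.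
- by rewrite (inv _ _ h1 z) (inv _ _ h1 z'); apply: congr.
- apply: cl; move: (congr Lr _ _ e).
  have q v : red (rcons (rcons v Rho) Lr) = red (rcons v Ll).
    by apply: val_inj; rewrite /= -!cats1 -catA !foldr_cat.
  by rewrite !q.
- by rewrite (inv _ _ h3 z) (inv _ _ h3 z'); apply: congr.
Qed.

Lemma red_cancel w z z' : red (z ++ w) = red (z' ++ w) -> red z = red z'.
Proof.
elim: w z z' => [|a w IH] z z'; first by rewrite !cats0.
by rewrite -!cat_rcons => /IH; apply: red_cancel_letter.
Qed.

Lemma retargetE (At : Type) (s : rsubst At) (w y x : rseq) (p : At) z :
  reduces (z ++ w) x -> retarget s w y x p = s (red (z ++ y)) p.
Proof.
move=> zx; rewrite /retarget; case: pselect => [h|[]]; last by exists z.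
case: cid => /= z' zx'.
suff e : red z' = red z by rewrite red_catl e -red_catl.
apply: (@red_cancel w); apply: val_inj => /=.
by rewrite (reduces_nf zx) (reduces_nf zx').
Qed.

(** * Rules and derivations *)

(* In the four elimination-like rules whose action on substitutions depends on
   the distinguished occurrence of X in the conclusion Y(X), the path to that
   occurrence is recorded: the labels alone need not determine it. *)
Inductive rule : Type :=
| Id
| ImpI
| ImpE
| OrI1
| OrI2
| OrE of seq side
| AndI
| AndE of seq side
| FusI
| FusE of seq side
| NegI
| NegE
| Cut of seq side
| EB
| EC
| EW
| EK.

Definition arity (R : rule) : nat :=
  match R with
  | Id => 0
  | ImpI | OrI1 | OrI2 | NegE | EB | EC | EW | EK => 1
  | ImpE | AndI | AndE _ | FusI | FusE _ | NegI | Cut _ => 2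
  | OrE _ => 3
  end.

(* [instance R premises conclusion]. *)
Inductive instance (At : Type) :
    rule -> seq (consecution At) -> consecution At -> Prop :=
| inst_Id (A : formula At) :
    instance Id [::] (A ⇒ A)
| inst_ImpI (X : bunch At) (A B : formula At) :
    instance ImpI [:: Semi X A ⇒ B] (X ⇒ Imp A B)
| inst_ImpE (X Y : bunch At) (A B : formula At) :
    instance ImpE [:: X ⇒ Imp A B; Y ⇒ A] (Semi X Y ⇒ B)
| inst_OrI1 (X : bunch At) (A B : formula At) :
    instance OrI1 [:: X ⇒ A] (X ⇒ Or A B)
| inst_OrI2 (X : bunch At) (A B : formula At) :
    instance OrI2 [:: X ⇒ B] (X ⇒ Or A B)
| inst_OrE (X : bunch At) (Y : bctx At) (A B C : formula At) :
    instance (OrE (hole_path Y))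
      [:: X ⇒ Or A B; fill Y A ⇒ C; fill Y B ⇒ C] (fill Y X ⇒ C)
| inst_AndI (X Y : bunch At) (A B : formula At) :
    instance AndI [:: X ⇒ A; Y ⇒ B] (Comma X Y ⇒ And A B)
| inst_AndE (X : bunch At) (Y : bctx At) (A B C : formula At) :
    instance (AndE (hole_path Y))
      [:: X ⇒ And A B; fill Y (Comma A B) ⇒ C] (fill Y X ⇒ C)
| inst_FusI (X Y : bunch At) (A B : formula At) :
    instance FusI [:: X ⇒ A; Y ⇒ B] (Semi X Y ⇒ Fus A B)
| inst_FusE (X : bunch At) (Y : bctx At) (A B C : formula At) :
    instance (FusE (hole_path Y))
      [:: X ⇒ Fus A B; fill Y (Semi A B) ⇒ C] (fill Y X ⇒ C)
| inst_NegI (X : bunch At) (A B : formula At) :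
    instance NegI [:: X ⇒ B; A ⇒ Neg B] (X ⇒ Neg A)
| inst_NegE (X : bunch At) (A : formula At) :
    instance NegE [:: X ⇒ Neg (Neg A)] (X ⇒ A)
| inst_Cut (X : bunch At) (Y : bctx At) (A B : formula At) :
    instance (Cut (hole_path Y)) [:: X ⇒ A; fill Y A ⇒ B] (fill Y X ⇒ B)
| inst_EB (W : bctx At) (X Y Z : bunch At) (A : formula At) :
    instance EB [:: fill W (Comma X (Comma Y Z)) ⇒ A]
                (fill W (Comma (Comma X Y) Z) ⇒ A)
| inst_EC (W : bctx At) (X Y : bunch At) (A : formula At) :
    instance EC [:: fill W (Comma X Y) ⇒ A] (fill W (Comma Y X) ⇒ A)
| inst_EW (W : bctx At) (X : bunch At) (A : formula At) :
    instance EW [:: fill W (Comma X X) ⇒ A] (fill W X ⇒ A)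
| inst_EK (W : bctx At) (X Y : bunch At) (A : formula At) :
    instance EK [:: fill W X ⇒ A] (fill W (Comma X Y) ⇒ A).

(* [Leaf c] is a consecution node with no rule node above it; [Infer c R Ts] is
   a consecution node c, below a rule node R, below the premise subtrees Ts. *)
Inductive ptree (At : Type) : Type :=
| Leaf of consecution At
| Infer of consecution At & rule & seq (ptree At).

Definition root_label (At : Type) (T : ptree At) : consecution At :=
  match T with Leaf c => c | Infer c _ _ => c end.

Definition has_rule_node (At : Type) (T : ptree At) : bool :=
  match T with Leaf _ => false | Infer _ _ _ => true end.

Fixpoint pseudoderivation (At : Type) (T : ptree At) : bool :=
  match T with
  | Leaf _ => true
  | Infer _ R Ts => (size Ts == arity R) && all (@pseudoderivation At) Ts
  end.

Fixpoint all_instances (At : Type) (T : ptree At) : Prop :=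
  match T with
  | Leaf _ => True
  | Infer c R Ts =>
      instance R (map (@root_label At) Ts) c
      /\ foldr (fun S P => all_instances S /\ P) True Ts
  end.

Definition derivation (At : Type) (T : ptree At) : Prop :=
  [/\ pseudoderivation T, has_rule_node T & all_instances T].

(** * Action of substitutions on derivations *)

(* The annotation of the node at path [pi] in [Y], when the root of [Y] is
   annotated with [x].  Only bunch nodes are needed; the last clause is a dummy
   value for paths that leave the bunch. *)
Fixpoint annot (At : Type) (x : rseq) (Y : bunch At) (pi : seq side)
    {struct pi} : rseq :=
  match pi, Y with
  | [::], _ => x
  | Left :: pi', Comma Y1 _ => annot x Y1 pi'
  | Right :: pi', Comma _ Y2 => annot x Y2 pi'
  | Left :: pi', Semi Y1 _ => annot (red (Lam :: x)) Y1 pi'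
  | Right :: pi', Semi _ Y2 => annot (red (Rho :: x)) Y2 pi'
  | _ :: _, Fm _ => x
  end.

(* sigma_{R_(i+1)}, for the rule R with conclusion c; premises count from 0. *)
Definition premise_subst (At : Type) (R : rule) (c : consecution At)
    (s : rsubst At) (i : nat) : rsubst At :=
  match R, i with
  | ImpI, 0 => retarget s (single Lam) eps
  | ImpE, 0 | FusI, 0 => retarget s eps (single Lam)
  | ImpE, 1 | FusI, 1 => retarget s eps (single Rho)
  | OrE pi, 0 | AndE pi, 0 | FusE pi, 0 | Cut pi, 0 =>
      retarget s eps (annot eps (ant c) pi)
  | NegI, 1 => retarget s (single Ln) eps
  | _, _ => s
  end.

Definition mapi (T U : Type) (f : nat -> T -> U) : nat -> seq T -> seq U :=
  fix go i ts := match ts with [::] => [::] | t :: ts' => f i t :: go i.+1 ts' end.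

Fixpoint subst_tree (At : Type) (s : rsubst At) (x : rseq) (T : ptree At)
    : ptree At :=
  match T with
  | Leaf c => Leaf (subst_consecution s x c)
  | Infer c R Ts =>
      Infer (subst_consecution s x c) R
        (mapi (fun i S => subst_tree (premise_subst R c s i) x S) 0 Ts)
  end.

(* Main.v *)
Require Import Defs.
From mathcomp Require Import all_boot.
Local Open Scope bunch_scope.

(**
  The substitution [sigma_{w |-> y}] acts at annotation [red (z w)] as [sigma]
  acts at [red (z y)], for every sequence [z]; this passes from atoms to
  formulas and bunches because annotations grow on the left.  Each rule
  instance is then preserved: the premise substitutions move the annotations of
  the premises to those of the conclusion, the reductions of sequences
  (e.g. [l lambda ~> rho], [r lambda ~> epsilon] for the implication rules)
  being exactly what makes them agree.
*)

Set Implicit Arguments.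
Unset Strict Implicit.
Unset Printing Implicit Defensive.

(** The generated induction principle for [ptree] gives no hypothesis on the premise subtrees, which
    sit inside a list; here the [foldr] supplies it. *)
Lemma ptree_ind_all (At : Type) (P : ptree At -> Prop) :
  (forall c, P (Leaf c)) ->
  (forall c R Ts, foldr (fun T Q => P T /\ Q) True Ts -> P (Infer c R Ts)) ->
  forall T, P T.
Proof.
move=> PLeaf PInfer; fix IH 1 => -[c|c R Ts]; first exact: PLeaf.
by apply: PInfer; elim: Ts => //= T Ts IHTs; split.
Qed.

Lemma red_consr a z : red (a :: red z) = red (a :: z).
Proof. by apply: val_inj; rewrite /= (foldr_push_id (nf_reduced z)). Qed.

Lemma red_id (x : rseq) : red x = x.
Proof. by apply: val_inj; case: x => z rz /=; rewrite foldr_push_id. Qed.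

Lemma red_cons_eq a z z' x : red (z ++ z') = x -> red ((a :: z) ++ z') = red (a :: x).
Proof. by move=> <-; rewrite red_consr. Qed.

Section Retarget.
Variables (At : Type) (s : rsubst At) (w y : rseq).

(** Induction with [z] general: descending to a child prepends a letter to [z] and leaves the
    suffixes [w] and [y] untouched, so both equations persist down to the atoms, where [retargetE]
    applies. *)
Lemma subst_formula_retarget z x x' A :
  red (z ++ w) = x -> red (z ++ y) = x' ->
  subst_formula (retarget s w y) x A = subst_formula s x' A.
Proof.
elim: A z x x' => [p|A IH|A IHA B IHB|A IHA B IHB|A IHA B IHB|A IHA B IHB] z x x' ex ex'.
- by rewrite -ex -ex'; exact/retargetE/reduces_red.
- by congr Neg; apply: IH (red_cons_eq _ ex) (red_cons_eq _ ex').
- by rewrite /= (IHA _ _ _ ex ex') (IHB _ _ _ ex ex').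
- by rewrite /= (IHA _ _ _ ex ex') (IHB _ _ _ ex ex').
- congr Imp; first exact: IHA (red_cons_eq _ ex) (red_cons_eq _ ex').
  exact: IHB (red_cons_eq _ ex) (red_cons_eq _ ex').
- congr Fus; first exact: IHA (red_cons_eq _ ex) (red_cons_eq _ ex').
  exact: IHB (red_cons_eq _ ex) (red_cons_eq _ ex').
Qed.

Lemma subst_bunch_retarget z x x' X :
  red (z ++ w) = x -> red (z ++ y) = x' ->
  subst_bunch (retarget s w y) x X = subst_bunch s x' X.
Proof.
elim: X z x x' => [A|X IHX Y IHY|X IHX Y IHY] z x x' ex ex'.
- by rewrite /= (subst_formula_retarget _ ex ex').
- by rewrite /= (IHX _ _ _ ex ex') (IHY _ _ _ ex ex').
- congr Semi; first exact: IHX (red_cons_eq _ ex) (red_cons_eq _ ex').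
  exact: IHY (red_cons_eq _ ex) (red_cons_eq _ ex').
Qed.

End Retarget.

Lemma subst_consecution_retarget_eps (At : Type) (s : rsubst At) y c :
  subst_consecution (retarget s eps y) eps c = subst_consecution s y c.
Proof.
have e : red ([::] ++ eps) = eps by apply: val_inj.
by rewrite /subst_consecution (subst_bunch_retarget _ _ e (red_id y))
           (subst_formula_retarget _ _ e (red_id y)).
Qed.

Fixpoint subst_ctx (At : Type) (s : rsubst At) (x : rseq) (Y : bctx At) : bctx At :=
  match Y with
  | Hole => Hole At
  | CommaL Y1 Y2 => CommaL (subst_ctx s x Y1) (subst_bunch s x Y2)
  | CommaR Y1 Y2 => CommaR (subst_bunch s x Y1) (subst_ctx s x Y2)
  | SemiL Y1 Y2 =>
      SemiL (subst_ctx s (red (Lam :: x)) Y1) (subst_bunch s (red (Rho :: x)) Y2)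
  | SemiR Y1 Y2 =>
      SemiR (subst_bunch s (red (Lam :: x)) Y1) (subst_ctx s (red (Rho :: x)) Y2)
  end.

(** Unlike [annot], this recursion follows the context alone, so the value cannot depend on what
    fills the hole. *)
Fixpoint hole_annot (At : Type) (x : rseq) (Y : bctx At) : rseq :=
  match Y with
  | Hole => x
  | CommaL Y1 _ => hole_annot x Y1
  | CommaR _ Y2 => hole_annot x Y2
  | SemiL Y1 _ => hole_annot (red (Lam :: x)) Y1
  | SemiR _ Y2 => hole_annot (red (Rho :: x)) Y2
  end.

Lemma annot_fill (At : Type) x (Y : bctx At) X :
  annot x (fill Y X) (hole_path Y) = hole_annot x Y.
Proof. by elim: Y x => //= *. Qed.

(** Rule labels record the path, so a substituted instance must keep it. *)
Lemma hole_path_subst (At : Type) (s : rsubst At) x Y :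
  hole_path (subst_ctx s x Y) = hole_path Y.
Proof. by elim: Y x => //= [Y IH Z|Z Y IH|Y IH Z|Z Y IH] x; rewrite IH. Qed.

Lemma subst_fill (At : Type) (s : rsubst At) x Y X :
  subst_bunch s x (fill Y X) =
  fill (subst_ctx s x Y) (subst_bunch s (hole_annot x Y) X).
Proof. by elim: Y x => //= [Y IH Z|Z Y IH|Y IH Z|Z Y IH] x; rewrite IH. Qed.

Lemma instance_subst (At : Type) (s : rsubst At) R cs c :
  instance R cs c ->
  instance R
    (mapi (fun i => subst_consecution (premise_subst R c s i) eps) 0 cs)
    (subst_consecution s eps c).
Proof.
have redE z x : foldr push [::] z = rval x -> red z = x by move=> e; exact: val_inj.
have llam : red (Ll :: single Lam) = single Rho by exact: redE.
have rlam : red (Lr :: single Lam) = eps by exact: redE.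
have nn : red (Ln :: red (Ln :: eps)) = eps by exact: redE.
have lam : red (Lam :: eps) = single Lam by exact: redE.
have rho : red (Rho :: eps) = single Rho by exact: redE.
case=> {R cs c} /=.
- by move=> A; exact: inst_Id.
- move=> X A B.
  suff -> : subst_consecution (retarget s (single Lam) eps) eps (Semi X A ⇒ B) =
      (Semi (subst_bunch s eps X) (subst_formula s (red (Ll :: eps)) A)
         ⇒ subst_formula s (red (Lr :: eps)) B) by exact: inst_ImpI.
  (* In the premise, [X], [A], [B] fall under [Lam], [Rho] and the empty sequence: the reductions of
     [z ++ [:: Lam]] for [z] empty, [Ll], [Lr]. Dropping [Lam] leaves their annotations in the
     conclusion. *)
  congr (Semi _ (Fm _) ⇒ _).
  + by apply: (@subst_bunch_retarget _ _ _ _ [::]); exact: redE.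
  + by apply: (@subst_formula_retarget _ _ _ _ [:: Ll]); exact: redE.
  + by apply: (@subst_formula_retarget _ _ _ _ [:: Lr]); exact: redE.
- move=> X Y A B; rewrite !subst_consecution_retarget_eps /subst_consecution.
  (* Only one level is unfolded, keeping the [red] terms rewritable: below an implication at [Lam],
     [A] falls under [Rho], as in the second premise, and [B] under [eps], as in the conclusion. *)
  rewrite -[subst_formula s (single Lam) _]/(Imp _ _).
  rewrite -[subst_bunch s eps _]/(Semi _ _) llam rlam lam rho.
  exact: inst_ImpE.
- by move=> X A B; exact: inst_OrI1.
- by move=> X A B; exact: inst_OrI2.
- move=> X Y A B C.
  (* The first premise moves to the annotation of the hole, where [A] and [B] sit in the other
     premises. The other rules with a hole path work alike. *)
  rewrite annot_fill subst_consecution_retarget_eps /subst_consecution /=.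
  by rewrite !subst_fill -(hole_path_subst s eps Y); exact: inst_OrE.
- by move=> X Y A B; exact: inst_AndI.
- move=> X Y A B C.
  rewrite annot_fill subst_consecution_retarget_eps /subst_consecution /=.
  by rewrite !subst_fill -(hole_path_subst s eps Y); exact: inst_AndE.
- move=> X Y A B; rewrite !subst_consecution_retarget_eps /subst_consecution.
  rewrite -[subst_formula s eps _]/(Fus _ _) -[subst_bunch s eps _]/(Semi _ _) lam rho.
  exact: inst_FusI.
- move=> X Y A B C.
  rewrite annot_fill subst_consecution_retarget_eps /subst_consecution /=.
  by rewrite !subst_fill -(hole_path_subst s eps Y); exact: inst_FusE.
- move=> X A B.
  suff -> : subst_consecution (retarget s (single Ln) eps) eps (A ⇒ Neg B) =
      (subst_formula s (red (Ln :: eps)) A ⇒ Neg (subst_formula s eps B))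
    by exact: inst_NegI.
  (* [A] falls under [eps], the reduction of [Ln] twice, and moves to [Ln]; [B], below the negation,
     falls under [Ln] and moves to [eps]. *)
  congr (Fm _ ⇒ Neg _).
  + by apply: (@subst_formula_retarget _ _ _ _ [:: Ln]); exact: redE.
  + by apply: (@subst_formula_retarget _ _ _ _ [::]); exact: redE.
- move=> X A; rewrite /subst_consecution -[subst_formula s eps (Neg _)]/(Neg (Neg _)) nn.
  exact: inst_NegE.
- move=> X Y A B.
  rewrite annot_fill subst_consecution_retarget_eps /subst_consecution /=.
  by rewrite !subst_fill -(hole_path_subst s eps Y); exact: inst_Cut.
- by move=> W X Y Z A; rewrite /subst_consecution /= !subst_fill; exact: inst_EB.
- by move=> W X Y A; rewrite /subst_consecution /= !subst_fill; exact: inst_EC.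
- by move=> W X A; rewrite /subst_consecution /= !subst_fill; exact: inst_EW.
- by move=> W X Y A; rewrite /subst_consecution /= !subst_fill; exact: inst_EK.
Qed.

Lemma size_mapi (T U : Type) (f : nat -> T -> U) i ts : size (mapi f i ts) = size ts.
Proof. by elim: ts i => //= t ts IH i; rewrite IH. Qed.

Lemma root_label_subst (At : Type) (s : rsubst At) x T :
  root_label (subst_tree s x T) = subst_consecution s x (root_label T).
Proof. by case: T. Qed.

Lemma map_root_label_subst (At : Type) (s : nat -> rsubst At) x i Ts :
  map (@root_label At) (mapi (fun j => subst_tree (s j) x) i Ts) =
  mapi (fun j => subst_consecution (s j) x) i (map (@root_label At) Ts).
Proof. by elim: Ts i => //= T Ts IH i; rewrite root_label_subst IH. Qed.

Lemma pseudoderivation_subst (At : Type) (s : rsubst At) x T :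
  pseudoderivation (subst_tree s x T) = pseudoderivation T.
Proof.
elim/ptree_ind_all: T s => //= c R Ts IH s; rewrite size_mapi; congr (_ && _).
(* The index [0] is generalized because [mapi] increments it along the list. *)
elim: Ts IH 0 => //= T Ts IHTs [IHT /IHTs IH] i.
by rewrite IHT IH.
Qed.

(** The annotation stays [eps] at every node; only the substitution changes from premise to premise,
    so the induction keeps [s] general. *)
Lemma all_instances_subst (At : Type) (s : rsubst At) T :
  all_instances T -> all_instances (subst_tree s eps T).
Proof.
elim/ptree_ind_all: T s => //= c R Ts IH s [instR Ts_ok]; split.
  by rewrite map_root_label_subst; exact: instance_subst.
elim: Ts IH Ts_ok 0 {instR} => //= T Ts IHTs [IHT IH] [/IHT T_ok Ts_ok] i.
by split; [exact: T_ok | exact: IHTs].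
Qed.

Theorem theorem38 (At : Type)
  (At_countably_infinite : exists f : At -> nat, bijective f)
  (T : ptree At) (X : bunch At) (A : formula At) (sigma : rsubst At) :
  derivation T -> root_label T = (X ⇒ A) ->
  derivation (subst_tree sigma eps T) /\
  root_label (subst_tree sigma eps T) =
    (subst_bunch sigma eps X ⇒ subst_formula sigma eps A).
Proof.
case=> T_pseudo T_rule T_inst rootT; split; last by rewrite root_label_subst rootT.
split; first by rewrite pseudoderivation_subst.
  by case: T T_rule {T_pseudo T_inst rootT}.
exact: all_instances_subst.
Qed.
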